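(* Consider the hybrid system $\mathcal{H}=(C,f,D,G)$ described in the context, on a directed, weight-balanced, strongly connected weighted graph with $N$ agents. Suppose each agent $i\in\{1,\dots,N\}$ implements the distributed dynamic event-triggered coordination algorithm described in the context, triggering events when $\chi_i=0$ and $\hat{x}_i\neq x_i$, with design parameter $\sigma_i\in(0,1)$. Then all trajectories of the system asymptotically converge to the set $$\{q:\ \hat{\phi}_i=0\ \text{ for all } i\in\{1,\dots,N\}\}.$$
   Context: Graph. $\mathcal{G}$ is a directed, weight-balanced, strongly connected graph on vertices $\{1,\dots,N\}$, $N\ge 2$, with edge set $\mathcal{E}$ and weights $w_{ij}>0$ for $(i,j)\in\mathcal{E}$. If $(i,j)\in\mathcal{E}$, $j$ is an out-neighbor of $i$; $\mathcal{N}_i^{\text{out}}$ is the set of out-neighbors of $i$. The degree is $d_i=\sum_{j\in\mathcal{N}_i^{\text{out}}}w_{ij}$; weight-balanced means this out-degree equals the in-degree $\sum_{j:(j,i)\in\mathcal{E}}w_{ji}$ for every $i$. The Laplacian is $L=\mathrm{diag}(d_1,\dots,d_N)-A$, with $A$ the weighted adjacency matrix (entries $w_{ij}$). State. Agent $i$ has a physical state $x_i\in\mathbb{R}$, a last broadcast state $\hat{x}_i\in\mathbb{R}$, and a clock-like variable $\chi_i\in\mathbb{R}$; $q_i=(x_i,\hat{x}_i,\chi_i)$ and $q=(q_1,\dots,q_N)\in\mathbb{R}^{3N}$. Define $$e_i=x_i-\hat{x}_i,\qquad \hat{z}_i=(L\hat{x})_i=\sum_{j\in\mathcal{N}_i^{\text{out}}}w_{ij}(\hat{x}_i-\hat{x}_j),\qquad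 \hat{\phi}_i=\sum_{j\in\mathcal{N}_i^{\text{out}}}w_{ij}(\hat{x}_i-\hat{x}_j)^2 .$$ Hybrid system $\mathcal{H}=(C,f,D,G)$. Flow set $C=\{q:\chi_i\ge 0\ \forall i\}$, with flow $$\dot{x}_i=-\hat{z}_i,\qquad \dot{\hat{x}}_i=0,\qquad \dot{\chi}_i=\gamma_i:=\sigma_i\hat{\phi}_i+2e_i\hat{z}_i .$$ Jump set $D=\bigcup_i D_i$, $D_i=\{q:\chi_i\le 0\}$. An event (broadcast) of agent $i$ is the jump $q\mapsto g_i(q)$ which replaces $\hat{x}_i$ by $x_i$ and leaves every other component of $q$ unchanged; $G(q)$ is the set of all $g_i(q)$ with $q\in D_i$. Algorithm. At $t=0$ each agent sets $\hat{x}_i(0)=x_i(0)$ (arbitrary) and $\chi_i(0)=0$; set $t_0^i=0$. Agent $i$ triggers an event exactly when $\chi_i=0$ and $e_i\neq 0$, i.e. its event times are $$t^i_{\ell+1}=\inf\{t\ge t^i_\ell:\ \chi_i(t)=0\ \text{and}\ e_i(t)\ne 0\}$$ (values after the update at $t^i_\ell$; the infimum of the empty set is $+\infty$). At an event agent $i$ sets $\hat{x}_i=x_i$ and broadcasts it to its in-neighbors; otherwise the variables evolve by the flow above. The control input of agent $i$ is always $u_i=-\hat{z}_i$. Asymptotic convergence of a trajectory to a set means that the Euclidean distance from $q(t)$ to the set tends to $0$ as $t\to\infty$. *)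

(* Defs.v *)
From HB Require Import structures.
From mathcomp Require Import all_boot all_order all_algebra.
From mathcomp Require Import all_classical all_reals all_analysis.
Set Implicit Arguments.
Unset Strict Implicit.
Unset Printing Implicit Defensive.
Import Order.TTheory GRing.Theory Num.Theory.
Import numFieldNormedType.Exports.
Local Open Scope classical_set_scope.
Local Open Scope ring_scope.

(* [weight i j] is only meaningful when [edge i j] holds; every definition
   below reads weights along edges only. *)
Record wdigraph (R : realType) (N : nat) := WDigraph {
  edge : rel 'I_N;
  weight : 'I_N -> 'I_N -> R;
  weight_gt0 : forall i j, edge i j -> 0 < weight i j
}.

Section Graph.
Variables (R : realType) (N : nat) (Gr : wdigraph R N).

Definition strongly_connected : Prop := forall i j, connect (edge Gr) i j.

Definition out_degree (i : 'I_N) : R := \sum_(j | edge Gr i j) weight Gr i j.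
Definition in_degree (i : 'I_N) : R := \sum_(j | edge Gr j i) weight Gr j i.

Definition weight_balanced : Prop := forall i, out_degree i = in_degree i.

Definition adjacency : 'M[R]_N :=
  \matrix_(i, j) (if edge Gr i j then weight Gr i j else 0).

Definition laplacian : 'M[R]_N :=
  diag_mx (\row_i out_degree i) - adjacency.

End Graph.

(* Hybrid systems in the sense of Goebel, Sanfelice and Teel; the state space
   is the real vector space of m x n matrices. *)
Record hybrid_system (R : realType) (m n : nat) := HybridSystem {
  flow_set : set 'M[R]_(m, n);
  flow_map : 'M[R]_(m, n) -> 'M[R]_(m, n);
  jump_set : set 'M[R]_(m, n);
  jump_map : 'M[R]_(m, n) -> set 'M[R]_(m, n)
}.

(* The values of [arc_val] outside [arc_dom] are irrelevant. *)
Record hybrid_arc (R : realType) (m n : nat) := HybridArc {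
  arc_dom : set (R * nat);
  arc_val : R -> nat -> 'M[R]_(m, n)
}.

Section HybridSolutions.
Variables (R : realType) (m n : nat).
Implicit Types (E : set (R * nat)) (q : hybrid_arc R m n)
  (H : hybrid_system R m n).

(* A finite union of [s_j, s_(j+1)] x {j}, j < J, with
   0 = s_0 <= s_1 <= ... <= s_J. *)
Definition compact_hybrid_time_domain E : Prop :=
  exists (J : nat) (s : nat -> R),
    [/\ s 0%N = 0,
        (forall j, (j < J)%N -> s j <= s j.+1) &
        E = [set p | (p.2 < J)%N /\ s p.2 <= p.1 <= s p.2.+1]].

(* Truncations at T are not intersected with t >= 0: this forces E to lie in
   nonnegative times. *)
Definition hybrid_time_domain E : Prop :=
  forall T J, E (T, J) ->
    compact_hybrid_time_domain (E `&` [set p | p.1 <= T /\ (p.2 <= J)%N]).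

Definition arc_interval q (j : nat) : set R := [set t | arc_dom q (t, j)].

(* All flow maps used below are continuous, so that locally absolutely
   continuous solutions of the differential equation holding almost everywhere
   are the classical ones; flows are therefore required to be continuous on
   each interval and to satisfy the equation at every interior time. *)
Definition is_solution H q : Prop :=
  [/\ hybrid_time_domain (arc_dom q),
      arc_dom q (0, 0%N) /\
        (closure (flow_set H) `|` jump_set H) (arc_val q 0 0%N),
      (forall j i k,
        {within arc_interval q j, continuous (fun t : R => arc_val q t j i k)}),
      (forall j t, (arc_interval q j)° t ->
        flow_set H (arc_val q t j) /\
        forall i k, is_derive t (1 : R) (fun s : R => arc_val q s j i k)
                      (flow_map H (arc_val q t j) i k)) &
      (forall j t, arc_dom q (t, j) -> arc_dom q (t, j.+1) ->
        jump_set H (arc_val q t j) /\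
        jump_map H (arc_val q t j) (arc_val q t j.+1))].

Definition extends q q' : Prop :=
  arc_dom q `<=` arc_dom q' /\
  forall t j, arc_dom q (t, j) -> arc_val q' t j = arc_val q t j.

Definition maximal_in (S : set (hybrid_arc R m n)) q : Prop :=
  S q /\ forall q', S q' -> extends q q' -> arc_dom q' `<=` arc_dom q.

Definition eucl_dist (p q : 'M[R]_(m, n)) : R :=
  Num.sqrt (\sum_i \sum_k (p i k - q i k) ^+ 2).

Definition eucl_dist_set (q : 'M[R]_(m, n)) (S : set 'M[R]_(m, n)) : R :=
  inf [set eucl_dist q p | p in S].

(* The limit as t tends to infinity only makes sense for an arc whose ordinary
   time is unbounded (in particular, not Zeno), whence the first conjunct. *)
Definition asymptotically_converges q (S : set 'M[R]_(m, n)) : Prop :=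
  (forall T : R, exists t j, arc_dom q (t, j) /\ T <= t) /\
  (forall eps : R, 0 < eps -> exists T : R, forall t j,
     arc_dom q (t, j) -> T <= t -> eucl_dist_set (arc_val q t j) S < eps).

End HybridSolutions.

(* Row i of q : 'M_(N, 3) is q_i = (x_i, xhat_i, chi_i). *)
Section EventTriggered.
Variables (R : realType) (N : nat) (Gr : wdigraph R N) (sigma : 'I_N -> R).
Implicit Types (q : 'M[R]_(N, 3)) (i : 'I_N).

Definition pack (x xhat chi : 'I_N -> R) : 'M[R]_(N, 3) :=
  \matrix_(i, k) [:: x i; xhat i; chi i]`_k.

Definition phys q i : R := q i 0.
Definition bcast q i : R := q i 1.
Definition clock q i : R := q i 2.

Definition err q i : R := phys q i - bcast q i.

Definition zhat q i : R := (laplacian Gr *m \col_j bcast q j) i 0.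

Definition phihat q i : R :=
  \sum_(j | edge Gr i j) weight Gr i j * (bcast q i - bcast q j) ^+ 2.

Definition et_flow_set : set 'M[R]_(N, 3) := [set q | forall i, 0 <= clock q i].

Definition et_flow_map q : 'M[R]_(N, 3) :=
  pack (fun i => - zhat q i)
       (fun=> 0)
       (fun i => sigma i * phihat q i + 2 * err q i * zhat q i).

Definition et_jump_set_of i : set 'M[R]_(N, 3) := [set q | clock q i <= 0].

Definition et_jump_set : set 'M[R]_(N, 3) :=
  [set q | exists i, et_jump_set_of i q].

Definition broadcast i q : 'M[R]_(N, 3) :=
  pack (phys q) (fun k => if k == i then phys q i else bcast q k) (clock q).

Definition et_jump_map q : set 'M[R]_(N, 3) :=
  [set q' | exists i, et_jump_set_of i q /\ q' = broadcast i q].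

Definition et_system : hybrid_system R N 3 :=
  HybridSystem et_flow_set et_flow_map et_jump_set et_jump_map.

Definition triggered q i : Prop := clock q i = 0 /\ bcast q i <> phys q i.

(* Solutions of the hybrid system generated by the algorithm: initialization
   with xhat = x and chi = 0; only triggered agents broadcast; and a triggered
   agent does so at once, i.e. no ordinary time elapses while some agent is
   triggered.  Simultaneous events are successive jumps at the same time. *)
Definition algorithm_solution : set (hybrid_arc R N 3) :=
  [set q | [/\ is_solution et_system q,
     (forall i, bcast (arc_val q 0 0%N) i = phys (arc_val q 0 0%N) i /\
                clock (arc_val q 0 0%N) i = 0),
     (forall t j, arc_dom q (t, j) -> arc_dom q (t, j.+1) ->
        exists i, triggered (arc_val q t j) i /\
                  arc_val q t j.+1 = broadcast i (arc_val q t j)) &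
     (forall t j i, arc_dom q (t, j) -> triggered (arc_val q t j) i ->
        forall t', arc_dom q (t', j) -> t' <= t)]].

Definition trajectory : set (hybrid_arc R N 3) :=
  [set q | maximal_in algorithm_solution q].

End EventTriggered.

(* Main.v *)
Require Import Defs.
From mathcomp Require Import all_boot all_order all_algebra.
From mathcomp Require Import ring lra.
From mathcomp Require Import all_classical all_reals all_analysis.
Import Order.TTheory GRing.Theory Num.Theory.
Import numFieldNormedType.Exports.
Local Open Scope classical_set_scope.
Local Open Scope ring_scope.

Set Implicit Arguments.
Unset Strict Implicit.

(** Write [V = sum_i (x_i ^ 2 + chi_i)].  Along a flow the terms
    [2 e_i zhat_i] of the clocks turn the derivative [- 2 x_i zhat_i] of
    [x_i ^ 2] into [- 2 xhat_i zhat_i], and weight balance gives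
    [2 sum_i xhat_i zhat_i = sum_i phihat_i], so that V decreases at the rate
    [sum_i (1 - sigma_i) phihat_i] (lyapunov_flow).  Jumps change neither x nor
    chi, hence not V, and V is nonnegative because the clocks are (clock_ge0).

    Since xhat is constant between jumps, flows are explicit polynomials in time
    (arc_flow).  All integral estimates below are therefore replaced by
    inequalities that propagate along flows and jumps, and are proved by
    induction on hybrid time (hybrid_ind).

    The energy [W_i = chi_i + e_i ^ 2] of agent i grows at the rate
    [sigma_i phihat_i] and vanishes after each of its events.  Two consequences
    (since_last_broadcast):
    - [e_i] is the integral of [- zhat_i] since the last event and
      [zhat_i ^ 2 <= d_i phihat_i], so by Cauchy-Schwarz
      [sigma_i e_i ^ 2 <= d_i W_i] times the elapsed time.  At an event
      [W_i = e_i ^ 2 > 0], so at least [sigma_i / d_i] has elapsed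
      (min_inter_event_time).  In particular there is no Zeno behaviour, and a
      maximal solution lives for all time, because otherwise its end could be
      continued by a flow or by a jump (trajectory_complete).
    - W_i is at most [sigma_i / (1 - sigma_i)] times the decrease of V since the
      last event.  As V converges, the size [|e_i|] of the late jumps of xhat_i
      tends to 0 (late_jumps_small).

    Suppose now that [|xhat_i - xhat_k| > eps] at a late time for an edge (i, k).
    During half a dwell time there are at most N jumps, all of them tiny, so that
    this difference stays above [eps / 2] and V decreases by a fixed amount,
    which is impossible once V has almost reached its limit (gap_cvg).  By strong
    connectedness all differences of broadcast states tend to 0, and replacing
    every xhat_i by a single one of them gives a point of the target set close to
    the state (eucl_dist_consensus). *)

(** * Uniform bounds over finite families *)

Lemma finite_pos_lb (R : realType) (I : finType) (P : I -> R -> Prop) :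
    (forall i x y, 0 < x -> x <= y -> P i y -> P i x) ->
    (forall i, exists2 x, 0 < x & P i x) ->
  exists2 x, 0 < x & forall i, P i x.
Proof.
move=> mono ex.
have [f fP] := choice (fun i => let: ex_intro2 x x0 Px := ex i in
  ex_intro (fun x => 0 < x /\ P i x) x (conj x0 Px)).
have m0 : 0 < \big[Num.min/1]_i f i.
  by apply: lt_bigmin => // i _; case: (fP i).
exists (\big[Num.min/1]_i f i) => // i.
by apply: mono (fP i).2 => //; apply: bigmin_le_cond.
Qed.

Lemma finite_ub (R : realType) (I : finType) (P : I -> R -> Prop) :
    (forall i x y, x <= y -> P i x -> P i y) ->
    (forall i, exists x, P i x) ->
  exists x, forall i, P i x.
Proof.
move=> mono /choice[f fP]; exists (\sum_i `|f i|) => i.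
apply: mono (fP i); rewrite (bigD1 i)//= (le_trans (ler_norm _))// lerDl.
exact: sumr_ge0.
Qed.

(** * Algebra of the flow *)

Section Dynamics.
Variables (R : realType) (N : nat) (Gr : wdigraph R N) (sigma : 'I_N -> R).
Implicit Types (p : 'M[R]_(N, 3)) (i : 'I_N) (h : R).

Lemma phys_pack (x y c : 'I_N -> R) i : phys (pack x y c) i = x i.
Proof. by rewrite /phys mxE. Qed.

Lemma bcast_pack (x y c : 'I_N -> R) i : bcast (pack x y c) i = y i.
Proof. by rewrite /bcast mxE. Qed.

Lemma clock_pack (x y c : 'I_N -> R) i : clock (pack x y c) i = c i.
Proof. by rewrite /clock mxE. Qed.

Definition packE := (phys_pack, bcast_pack, clock_pack).

Lemma state_eqP p p' :
    (forall i, phys p i = phys p' i) -> (forall i, bcast p i = bcast p' i) ->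
    (forall i, clock p i = clock p' i) -> p = p'.
Proof.
move=> hx hy hc; apply/matrixP => i k.
case: k => [[|[|[|//]]] hk].
- by rewrite -(_ : 0 = Ordinal hk); [exact: hx | apply: val_inj].
- by rewrite -(_ : 1 = Ordinal hk); [exact: hy | apply: val_inj].
- by rewrite -(_ : 2 = Ordinal hk); [exact: hc | apply: val_inj].
Qed.

Lemma zhatE p i :
  zhat Gr p i = \sum_(j | edge Gr i j) weight Gr i j * (bcast p i - bcast p j).
Proof.
rewrite /zhat /laplacian mulmxBl !mxE.
under eq_bigr do rewrite !mxE.
rewrite (bigD1 i) //= eqxx mulr1n big1 ?addr0; last first.
  by move=> k ki; rewrite eq_sym (negbTE ki) mulr0n mul0r.
rewrite /out_degree mulr_suml [in RHS]big_mkcond [X in X - _]big_mkcond -sumrB.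
apply: eq_bigr => j _; rewrite !mxE; case: ifP => _; last by rewrite mul0r subrr.
by rewrite mulrBr.
Qed.

Lemma eq_zhat p p' i :
  (forall j, bcast p j = bcast p' j) -> zhat Gr p i = zhat Gr p' i.
Proof. by move=> e; rewrite !zhatE e; under eq_bigr do rewrite e. Qed.

Lemma eq_phihat p p' i :
  (forall j, bcast p j = bcast p' j) -> phihat Gr p i = phihat Gr p' i.
Proof. by move=> e; rewrite /phihat e; under eq_bigr do rewrite e. Qed.

Lemma phihat_ge0 p i : 0 <= phihat Gr p i.
Proof.
by apply: sumr_ge0 => j e; rewrite mulr_ge0 ?sqr_ge0// ltW// weight_gt0.
Qed.

Lemma phihat_edge p i j : edge Gr i j ->
  weight Gr i j * (bcast p i - bcast p j) ^+ 2 <= phihat Gr p i.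
Proof.
move=> e; rewrite /phihat (bigD1 j)//= lerDl; apply: sumr_ge0 => k /andP[ek _].
by rewrite mulr_ge0 ?sqr_ge0// ltW// weight_gt0.
Qed.

Lemma out_degree_ge0 i : 0 <= out_degree Gr i.
Proof. by apply: sumr_ge0 => j e; rewrite ltW// weight_gt0. Qed.

(** Cauchy-Schwarz for the weights of the edges leaving i. *)
Lemma zhat_sqr_le p i :
  zhat Gr p i ^+ 2 <= out_degree Gr i * phihat Gr p i.
Proof.
set d := out_degree Gr i.
have d0 : 0 <= d := out_degree_ge0 i.
have [d1|d1] := eqVneq d 0.
  have noe j : ~~ edge Gr i j.
    apply/negP => e; have : weight Gr i j <= d.
      rewrite /d /out_degree (bigD1 j)//= lerDl sumr_ge0// => k /andP[ek _].
      by rewrite ltW// weight_gt0.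
    by rewrite d1 leNgt weight_gt0.
  by rewrite d1 mul0r zhatE big1 ?expr0n// => j; rewrite (negbTE (noe j)).
have d2 : 0 < d by rewrite lt_def d1.
set z := zhat Gr p i; set f := phihat Gr p i.
have : 0 <= \sum_(j | edge Gr i j)
    weight Gr i j * (d * (bcast p i - bcast p j) - z) ^+ 2.
  by apply: sumr_ge0 => j e; rewrite mulr_ge0 ?sqr_ge0// ltW// weight_gt0.
suff -> : \sum_(j | edge Gr i j)
    weight Gr i j * (d * (bcast p i - bcast p j) - z) ^+ 2 =
    d * (d * f - z ^+ 2) by rewrite pmulr_rge0// subr_ge0.
transitivity (d ^+ 2 * f - 2 * d * z * z + z ^+ 2 * d); last by ring.
have -> : d ^+ 2 * f = \sum_(j | edge Gr i j)
    d ^+ 2 * (weight Gr i j * (bcast p i - bcast p j) ^+ 2) by rewrite mulr_sumr.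
have -> : 2 * d * z * z = \sum_(j | edge Gr i j)
    2 * d * z * (weight Gr i j * (bcast p i - bcast p j)).
  by rewrite -mulr_sumr -zhatE.
have -> : z ^+ 2 * d = \sum_(j | edge Gr i j) z ^+ 2 * weight Gr i j.
  by rewrite -mulr_sumr.
by rewrite -sumrB -big_split/=; apply: eq_bigr => j _; ring.
Qed.

Hypothesis hbal : weight_balanced Gr.

(** Weight balance makes the Laplacian form the Dirichlet form of the graph. *)
Lemma dirichlet p :
  \sum_i bcast p i * zhat Gr p i = 2^-1 * \sum_i phihat Gr p i.
Proof.
pose y := bcast p.
have swap (F : 'I_N -> R) : \sum_i \sum_(j | edge Gr i j) weight Gr i j * F j =
    \sum_i \sum_(j | edge Gr i j) weight Gr i j * F i.
  rewrite (exchange_big_dep predT)//=; apply: eq_bigr => i _.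
  rewrite -!mulr_suml; congr (_ * _).
  by move: (hbal i); rewrite /out_degree /in_degree => ->.
have := swap (fun i => y i ^+ 2).
have -> : \sum_i phihat Gr p i =
   2 * \sum_i bcast p i * zhat Gr p i
   + (\sum_i \sum_(j | edge Gr i j) weight Gr i j * y j ^+ 2
     - \sum_i \sum_(j | edge Gr i j) weight Gr i j * y i ^+ 2).
  rewrite mulr_sumr -sumrB -big_split/=; apply: eq_bigr => i _.
  rewrite zhatE /phihat !mulr_sumr -sumrB -big_split/=.
  by apply: eq_bigr => j _; rewrite /y; ring.
by move=> ->; rewrite subrr addr0 mulrA mulVf ?mul1r.
Qed.

(** Since xhat is constant along a flow, so is zhat; hence x is affine in time
    and chi quadratic. *)
Definition flow h p : 'M[R]_(N, 3) :=
  pack (fun i => phys p i - h * zhat Gr p i) (bcast p)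
    (fun i => clock p i
       + h * (sigma i * phihat Gr p i + 2 * err p i * zhat Gr p i)
       - h ^+ 2 * zhat Gr p i ^+ 2).

Lemma bcast_flow h p i : bcast (flow h p) i = bcast p i.
Proof. by rewrite packE. Qed.

Lemma zhat_flow h p i : zhat Gr (flow h p) i = zhat Gr p i.
Proof. by apply: eq_zhat => j; rewrite bcast_flow. Qed.

Lemma phihat_flow h p i : phihat Gr (flow h p) i = phihat Gr p i.
Proof. by apply: eq_phihat => j; rewrite bcast_flow. Qed.

Lemma err_flow h p i : err (flow h p) i = err p i - h * zhat Gr p i.
Proof. by rewrite /err !packE addrAC. Qed.

Lemma flow0 p : flow 0 p = p.
Proof. by apply: state_eqP => i; rewrite !packE //; ring. Qed.

Lemma flowD h h' p : flow h' (flow h p) = flow (h + h') p.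
Proof.
apply: state_eqP => i; rewrite !packE ?zhat_flow ?phihat_flow ?err_flow//; ring.
Qed.

(** Twice e_i zhat_i is minus the derivative of e_i ^ 2, so that this sum grows
    exactly at the rate sigma_i phihat_i along flows; it vanishes right after
    every event of agent i, which happens with a zero clock. *)
Definition energy p i : R := clock p i + err p i ^+ 2.

Lemma energy_flow h p i :
  energy (flow h p) i = energy p i + h * (sigma i * phihat Gr p i).
Proof. by rewrite /energy err_flow packE; ring. Qed.

Definition lyapunov p : R := \sum_i (phys p i ^+ 2 + clock p i).

(** The error terms of the clocks cancel those of [x_i = xhat_i + e_i], and the
    quadratic terms in h cancel each other; the Dirichlet form remains. *)
Lemma lyapunov_flow h p :
  lyapunov (flow h p) = lyapunov p - h * \sum_i (1 - sigma i) * phihat Gr p i.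
Proof.
have := dirichlet p => dir.
have -> : \sum_i (1 - sigma i) * phihat Gr p i =
  2 * (\sum_i bcast p i * zhat Gr p i) - \sum_i sigma i * phihat Gr p i.
  by rewrite dir mulrA mulfV ?mul1r// -sumrB; apply: eq_bigr => i _; ring.
rewrite !mulr_sumr -sumrB mulr_sumr /lyapunov -sumrB.
by apply: eq_bigr => i _; rewrite !packE /err; ring.
Qed.

Lemma phys_broadcast k p i : phys (broadcast k p) i = phys p i.
Proof. by rewrite packE. Qed.

Lemma clock_broadcast k p i : clock (broadcast k p) i = clock p i.
Proof. by rewrite packE. Qed.

Lemma bcast_broadcast k p i :
  bcast (broadcast k p) i = if i == k then phys p k else bcast p i.
Proof. by rewrite packE; case: eqP => // ->. Qed.

Lemma err_broadcast k p i :
  err (broadcast k p) i = if i == k then 0 else err p i.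
Proof. by rewrite /err !packE; case: eqP => // ->; rewrite subrr. Qed.

Lemma lyapunov_broadcast k p : lyapunov (broadcast k p) = lyapunov p.
Proof. by apply: eq_bigr => i _; rewrite phys_broadcast clock_broadcast. Qed.

Hypothesis hsigma : forall i, 0 < sigma i < 1.

Lemma dissipation_ge p i :
  (1 - sigma i) * phihat Gr p i <= \sum_k (1 - sigma k) * phihat Gr p k.
Proof.
rewrite (bigD1 i)//= lerDl; apply: sumr_ge0 => k _.
by rewrite mulr_ge0 ?phihat_ge0// subr_ge0 ltW//; case/andP: (hsigma k).
Qed.

Lemma dissipation_ge0 p : 0 <= \sum_k (1 - sigma k) * phihat Gr p k.
Proof.
apply: sumr_ge0 => k _.
by rewrite mulr_ge0 ?phihat_ge0// subr_ge0 ltW//; case/andP: (hsigma k).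
Qed.

Lemma lyapunov_ge0 p : (forall i, 0 <= clock p i) -> 0 <= lyapunov p.
Proof. by move=> h; apply: sumr_ge0 => i _; rewrite addr_ge0 ?sqr_ge0. Qed.

(** Cauchy-Schwarz in the plane, in a form without divisions, so that t and h may
    vanish. *)
Lemma sqr_sub_le_mul (t h A B a b : R) : 0 <= t -> 0 <= h -> 0 <= A -> 0 <= B ->
  a ^+ 2 <= t * A -> b ^+ 2 <= h * B -> (a - b) ^+ 2 <= (t + h) * (A + B).
Proof.
move=> t0 h0 A0 B0 ha hb.
have tB : 0 <= t * B by rewrite mulr_ge0.
have hA : 0 <= h * A by rewrite mulr_ge0.
have key : `|2 * (a * b)| <= t * B + h * A.
  rewrite -(ler_pXn2r (n := 2))// ?nnegrE ?addr_ge0//.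
  rewrite real_normK ?num_real//.
  have : a ^+ 2 * b ^+ 2 <= (t * A) * (h * B) by rewrite ler_pM ?sqr_ge0.
  have := sqr_ge0 (t * B - h * A).
  nra.
have := ler_norm (- (2 * (a * b))); rewrite normrN => key2.
nra.
Qed.

(** The error is the integral of [- zhat] over the time [t] elapsed since the
    last broadcast, the energy the integral of [sigma * phihat], and
    [zhat ^ 2 <= d * phihat].  This is the resulting integral Cauchy-Schwarz
    inequality, in a form that propagates along flows. *)
Lemma err_bound_flow t h p i : 0 <= t -> 0 <= h -> 0 <= energy p i ->
  sigma i * err p i ^+ 2 <= out_degree Gr i * t * energy p i ->
  sigma i * err (flow h p) i ^+ 2 <=
    out_degree Gr i * (t + h) * energy (flow h p) i.
Proof.
move=> t0 h0 W0 H; rewrite err_flow energy_flow.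
case/andP: (hsigma i) => s0 _.
set d := out_degree Gr i in H *; set s := sigma i in H s0 *.
have := zhat_sqr_le p i; rewrite -/d.
have d0 : 0 <= d := out_degree_ge0 i.
have f0 := phihat_ge0 p i.
move: (zhat _ _ _) (phihat _ _ _) f0 (err _ _) (energy _ _) H W0.
move=> z f f0 e W H W0 zf.
rewrite -(ler_pM2l s0).
have -> : s * (s * (e - h * z) ^+ 2) = (s * e - s * (h * z)) ^+ 2 by ring.
have -> : s * (d * (t + h) * (W + h * (s * f))) =
  (t + h) * (s * d * W + s * s * d * f * h) by ring.
apply: sqr_sub_le_mul => //.
- by rewrite !mulr_ge0// ltW.
- by rewrite !mulr_ge0// ltW.
- have -> : (s * e) ^+ 2 = s * (s * e ^+ 2) by ring.
  have -> : t * (s * d * W) = s * (d * t * W) by ring.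
  by rewrite ler_pM2l.
- have -> : h * (s * s * d * f * h) = (s * h) ^+ 2 * (d * f) by ring.
  have -> : (s * (h * z)) ^+ 2 = (s * h) ^+ 2 * z ^+ 2 by ring.
  by rewrite ler_wpM2l ?sqr_ge0.
Qed.

End Dynamics.

(** * Hybrid time domains without branching *)

Section TimeDomain.
Variable R : realType.
Implicit Types (E : set (R * nat)) (t u s : R) (j k : nat).

(** The truncations at (T, J) only see times up to T, so that a hybrid time
    domain may still contain times after T at levels below J.  The last clause
    excludes this. *)
Definition linear_time_domain E : Prop :=
  [/\ forall t, E (t, 0%N) -> 0 <= t /\ forall u, 0 <= u <= t -> E (u, 0%N),
      forall t j, E (t, j.+1) -> exists s, [/\ s <= t, E (s, j) &
        forall u, s <= u <= t -> E (u, j.+1)] &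
      forall t j t' j', (j < j')%N -> E (t, j) -> E (t', j') -> t <= t'].

Lemma linear_hybrid_time_domain E :
  linear_time_domain E -> hybrid_time_domain E.
Proof.
move=> [E0 ES time_le] T J ETJ.
suff [s [s0 sS sT sE]] : exists s : nat -> R, [/\ s 0%N = 0,
    forall j, (j < J.+1)%N -> s j <= s j.+1, s J.+1 = T &
    E `&` [set p | p.1 <= T /\ (p.2 <= J)%N] =
      [set p | (p.2 < J.+1)%N /\ s p.2 <= p.1 <= s p.2.+1]].
  by exists J.+1, s.
elim: J T ETJ => [|J IH] T ETJ.
  have [T0 ET] := E0 _ ETJ.
  exists (fun j => if j is 0%N then 0 else T); split=> //; first by case.
  apply/seteqP; split=> -[t j] /= [].
    move=> + [tT]; rewrite leqn0 => + /eqP j0; rewrite j0 => Et.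
    by have [-> _] := E0 _ Et.
  rewrite ltnS leqn0 => /eqP -> tT; have /andP[_ ->] := tT.
  by split=> //; exact: ET.
have [u [uT EuJ EuT]] := ES _ _ ETJ.
have Eu : E (u, J.+1) by apply: EuT; rewrite lexx.
have [s [s0 sS su sE]] := IH _ EuJ.
exists (fun j => if (j <= J.+1)%N then s j else T).
rewrite /= ltnn; split=> // [j|].
  rewrite ltnS => jJ; rewrite jJ; case: ltnP => [|jJ']; first exact: sS.
  by rewrite (_ : j = J.+1) ?su//; apply/anti_leq; rewrite jJ.
have inv t j : (j <= J)%N ->
    E (t, j) <-> s j <= t <= s j.+1.
  move=> jJ; have /seteqP[sub1 sub2] := sE; split=> [Et|st].
    have [] : (j < J.+1)%N /\ s j <= t <= s j.+1; last by [].
    apply: (sub1 (t, j)); split=> //=; split=> //.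
    by apply: (time_le _ _ _ _ _ Et Eu); rewrite ltnS.
  by have [] := sub2 (t, j) (conj (_ : (j < J.+1)%N) st).
apply/seteqP; split=> -[t j] /= [].
  move=> Et [tT jJ1]; rewrite ltnS jJ1 ltnS; split=> //.
  have [jJ|Jj] := leqP j J; first exact/(inv t j jJ).
  have jJ : j = J.+1 by apply/anti_leq; rewrite jJ1.
  by rewrite tT jJ su (time_le _ _ _ _ (ltnSn J) EuJ)// -jJ.
rewrite ltnS => jJ1; rewrite jJ1 ltnS; have [jJ|Jj] := leqP j J => st.
  have Et := (inv t j jJ).2 st; do !split=> //.
  by apply: le_trans uT; apply: (time_le _ _ _ _ _ Et Eu); rewrite ltnS.
have jJ : j = J.+1 by apply/anti_leq; rewrite jJ1.
rewrite jJ su in st *; have /andP[_ tT] := st.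
by do !split=> //; exact: EuT.
Qed.

(** The hypothesis holds for the algorithm because no time elapses while an
    agent is triggered. *)
Lemma hybrid_time_domain_linear E : hybrid_time_domain E ->
    (forall t j, E (t, j) -> E (t, j.+1) -> forall t', E (t', j) -> t' <= t) ->
  linear_time_domain E.
Proof.
move=> Ehtd nobranch.
have ES t j : E (t, j.+1) -> exists s, [/\ s <= t, E (s, j) &
        forall u, s <= u <= t -> E (u, j.+1)].
  move=> Et; have [J [s [s0 sS /seteqP[sub1 sub2]]]] := Ehtd _ _ Et.
  have /= [jJ /andP[st ts]] := sub1 (t, j.+1)
    (conj Et (conj (lexx t) (leqnn j.+1))).
  exists (s j.+1); split=> //.
    by have [] := sub2 (s j.+1, j);
      [split=> /=; [exact: ltnW | rewrite sS ?lexx// ltnW] |].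
  move=> u /andP[su ut].
  by have [] := sub2 (u, j.+1); [split=> //=; rewrite su (le_trans ut)|].
split=> //.
  move=> t Et; have [J [s [s0 sS /seteqP[sub1 sub2]]]] := Ehtd _ _ Et.
  have /= [jJ /andP[st ts]] := sub1 (t, 0%N)
    (conj Et (conj (lexx t) (leqnn 0%N))).
  rewrite -s0; split=> // u /andP[su ut].
  by have [] := sub2 (u, 0%N); [split=> //=; rewrite su (le_trans ut)|].
move=> t j t' j'; elim: j' t' => // j' IH t' jj' Et /ES[s [st' Es Est']].
apply: (le_trans _ st'); move: jj'.
rewrite ltnS leq_eqVlt => /predU1P[jE|jj']; last exact: (IH _ jj' Et Es).
rewrite jE in Et; apply: (nobranch _ _ Es _ _ Et).
by apply: Est'; rewrite lexx.
Qed.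

Variable E : set (R * nat).
Hypothesis Elin : linear_time_domain E.

Lemma time_ge0 t j : E (t, j) -> 0 <= t.
Proof.
case: Elin => E0 ES _; elim: j t => [|j IH] t; first by move=> /E0[].
by move=> /ES[s [st /IH s0 _]]; exact: le_trans st.
Qed.

Lemma time_mono t j t' j' : (j < j')%N -> E (t, j) -> E (t', j') -> t <= t'.
Proof. by case: Elin => _ _; apply. Qed.

Lemma time_convex t u t' j : E (t, j) -> E (t', j) -> t <= u <= t' -> E (u, j).
Proof.
case: Elin => E0 ES _ Et Et' /andP[tu ut']; case: j Et Et' => [|j] Et Et'.
  by apply: (E0 _ Et').2; rewrite ut' (le_trans _ tu)// (time_ge0 Et).
have [s [st' Es]] := ES _ _ Et'; apply.
by rewrite ut' (le_trans _ tu)// (time_mono _ Es Et).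
Qed.

Lemma jump_time t' j j' : (j < j')%N -> E (t', j') ->
  exists s, [/\ s <= t', E (s, j) & E (s, j.+1)].
Proof.
case: Elin => _ ES _; elim: j' t' => // j' IH t'.
rewrite ltnS leq_eqVlt => /predU1P[->|jj'] /ES[s [st Es Est]].
  by exists s; split=> //; apply: Est; rewrite lexx.
by have [u [us Eu Eu']] := IH _ jj' Es; exists u; split=> //; exact: le_trans st.
Qed.

Lemma level_time t' j j' : (j <= j')%N -> E (t', j') ->
  exists s, s <= t' /\ E (s, j).
Proof.
rewrite leq_eqVlt => /predU1P[<- Et'|jj' Et']; first by exists t'.
by have [s [? ? ?]] := jump_time jj' Et'; exists s.
Qed.

Lemma time_hit u t j : E (t, j) -> 0 <= u <= t ->
  exists k, (k <= j)%N /\ E (u, k).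
Proof.
case: Elin => E0 ES _; elim: j t => [|j IH] t Et /andP[u0 ut].
  by exists 0%N; split=> //; apply: (E0 _ Et).2; rewrite u0.
have [s [st Es Est]] := ES _ _ Et.
have [su|us] := leP s u.
  by exists j.+1; split=> //; apply: Est; rewrite su.
have [|k [kj Ek]] := IH _ Es; first by rewrite u0 ltW.
by exists k; split=> //; exact: leqW.
Qed.

(** Every later point is reached from the base point by finitely many flows and
    jumps, so that an invariant has to be checked for these two steps only. *)
Lemma hybrid_ind (P : R -> nat -> Prop) a j0 : E (a, j0) -> P a j0 ->
    (forall t t' j, E (t, j) -> E (t', j) -> a <= t -> (j0 <= j)%N ->
       t < t' -> P t j -> P t' j) ->
    (forall t j, E (t, j) -> E (t, j.+1) -> a <= t -> (j0 <= j)%N ->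
       P t j -> P t j.+1) ->
  forall t j, E (t, j) -> a <= t -> (j0 <= j)%N -> P t j.
Proof.
move=> Ea Pa Pflow Pjump.
have Pflow' t t' j : E (t, j) -> E (t', j) -> a <= t -> (j0 <= j)%N ->
    t <= t' -> P t j -> P t' j.
  move=> Et Et' at_ j0j; rewrite le_eqVlt => /predU1P[->//|].
  exact: Pflow.
move=> t j Et at_ j0j; elim: j j0j t Et at_ => [|j IH].
  by rewrite leqn0 => /eqP j00 t Et at_; rewrite j00 in Ea Pa;
     apply: Pflow' Pa; rewrite ?j00.
rewrite leq_eqVlt => /predU1P[j0E t Et at_|j0j t Et at_].
  by rewrite j0E in Ea Pa Pflow'; exact: Pflow' Pa.
have [_ ES _] := Elin; have [s [st Es Est]] := ES _ _ Et.
have Es' : E (s, j.+1) by apply: Est; rewrite lexx.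
have as_ : a <= s by exact: time_mono Ea Es'.
by apply: (Pflow' s) => //; [exact: ltnW | apply: Pjump => //; exact: IH].
Qed.

End TimeDomain.

(** * Flows as solutions of the differential equation *)

Section Calculus.
Variable R : realType.

Lemma is_derive_quadratic (s a b c t : R) :
  is_derive t (1 : R) (fun u : R => a + (u - s) * b + (u - s) ^+ 2 * c)
    (b + 2 * (t - s) * c).
Proof.
apply: is_derive_eq; rewrite /GRing.scale/= !(mulr0, mul0r, addr0, add0r, mulr1).
by ring.
Qed.

Lemma continuous_quadratic (s a b c : R) :
  continuous (fun u : R => a + (u - s) * b + (u - s) ^+ 2 * c).
Proof.
move=> t; apply: differentiable_continuous; apply/derivable1_diffP.
by have [] := is_derive_quadratic s a b c t.
Qed.

Lemma increment_eq (f g df : R -> R) (a b : R) : a <= b ->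
    {within `[a, b], continuous f} -> continuous g ->
    (forall x, a < x < b -> is_derive x 1 f (df x)) ->
    (forall x, a < x < b -> is_derive x 1 g (df x)) ->
  f b - f a = g b - g a.
Proof.
move=> ab cf cg Df Dg.
have [||c _] := @MVT_segment R (f - g) (fun=> 0) a b ab.
- move=> x; rewrite in_itv/= => axb.
  have := is_deriveB (Df _ axb) (Dg _ axb).
  by rewrite subrr.
- move=> x; apply: cvgB; first exact: cf.
  exact: (@continuous_subspaceT _ _ _ _ cg x).
by rewrite mul0r !fctE => /eqP; rewrite subr_eq0 => /eqP; lra.
Qed.

End Calculus.

Section Solutions.
Variables (R : realType) (N : nat) (Gr : wdigraph R N) (sigma : 'I_N -> R).
Implicit Types (p : 'M[R]_(N, 3)) (i k : 'I_N) (t s h : R) (j : nat).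

Lemma flow_entry h p i (c : 'I_3) :
  flow Gr sigma h p i c =
    p i c + h * et_flow_map Gr sigma p i c
    + h ^+ 2 * pack (fun=> 0) (fun=> 0) (fun i => - zhat Gr p i ^+ 2) i c.
Proof.
case: c => [[|[|[|//]]] hc]; rewrite !mxE/=.
- by rewrite /phys (_ : Ordinal hc = 0); [ring | apply: val_inj].
- by rewrite /bcast (_ : Ordinal hc = 1); [ring | apply: val_inj].
- by rewrite /clock (_ : Ordinal hc = 2); [ring | apply: val_inj].
Qed.

Lemma flow_map_entry h p i (c : 'I_3) :
  et_flow_map Gr sigma (flow Gr sigma h p) i c =
    et_flow_map Gr sigma p i c
    + 2 * h * pack (fun=> 0) (fun=> 0) (fun i => - zhat Gr p i ^+ 2) i c.
Proof.
case: c => [[|[|[|//]]] hc]; rewrite !mxE/=.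
- by rewrite zhat_flow; ring.
- by ring.
- by rewrite zhat_flow phihat_flow err_flow; ring.
Qed.

Lemma is_derive_flow s p i (c : 'I_3) t :
  is_derive t (1 : R) (fun u : R => flow Gr sigma (u - s) p i c)
    (et_flow_map Gr sigma (flow Gr sigma (t - s) p) i c).
Proof.
rewrite flow_map_entry; under eq_fun do rewrite flow_entry.
exact: is_derive_quadratic.
Qed.

Lemma continuous_flow s p i (c : 'I_3) :
  continuous (fun u : R => flow Gr sigma (u - s) p i c).
Proof.
under eq_fun do rewrite flow_entry.
exact: continuous_quadratic.
Qed.

Variable q : hybrid_arc R N 3.
Hypothesis hq : algorithm_solution Gr sigma q.
Local Notation E := (arc_dom q).

Lemma solution_domain : linear_time_domain E.
Proof.
have [[htd _ _ _ _] _ jmp imm] := hq.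
apply: hybrid_time_domain_linear => // t j Et Et' t' E't.
by have [k [trig _]] := jmp _ _ Et Et'; exact: imm trig _ E't.
Qed.

Lemma arc_interval_interior t u t' j : E (t, j) -> E (t', j) -> t < u < t' ->
  (arc_interval q j)° u.
Proof.
move=> Et Et' tu.
have : u \in `]t, t'[ by rewrite in_itv.
move=> /near_in_itvoo; apply: filterS => v; rewrite in_itv/= => /andP[tv vt'].
by apply: (time_convex solution_domain Et Et'); rewrite !ltW.
Qed.

Lemma arc_continuous t t' j i (c : 'I_3) : E (t, j) -> E (t', j) ->
  {within `[t, t'], continuous (fun u : R => arc_val q u j i c)}.
Proof.
move=> Et Et'; have [[_ _ cont _ _] _ _ _] := hq.
apply: continuous_subspaceW (cont j i c) => u /=; rewrite in_itv/= => tu.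
exact: (time_convex solution_domain Et Et').
Qed.

(** Uniqueness of solutions: xhat is constant, then x is affine, then chi is
    determined by its derivative. *)
Lemma arc_flow t t' j : E (t, j) -> E (t', j) -> t <= t' ->
  arc_val q t' j = flow Gr sigma (t' - t) (arc_val q t j).
Proof.
move=> Et Et' tt'; set p := arc_val q t j.
have [[_ _ _ ode _] _ _ _] := hq.
have step (c : 'I_3) : (forall u i, t < u < t' ->
      et_flow_map Gr sigma (arc_val q u j) i c =
      et_flow_map Gr sigma (flow Gr sigma (u - t) p) i c) ->
    forall u i, t <= u <= t' ->
      arc_val q u j i c = flow Gr sigma (u - t) p i c.
  move=> heq u i /andP[tu ut'].
  have Eu : E (u, j) by apply: (time_convex solution_domain Et Et'); rewrite tu.
  have := @increment_eq R (fun v => arc_val q v j i c)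
     (fun v => flow Gr sigma (v - t) p i c)
     (fun v => et_flow_map Gr sigma (flow Gr sigma (v - t) p) i c) t u tu
     (@arc_continuous t u j i c Et Eu) (@continuous_flow t p i c) _
     (fun v _ => is_derive_flow t p i c v).
  rewrite subrr flow0 -/p => inc.
  have {}inc : arc_val q u j i c - p i c = flow Gr sigma (u - t) p i c - p i c.
    apply: inc => v /andP[tv vu].
    rewrite -heq ?tv ?(lt_le_trans vu)//.
    by have [_] := ode _ _ (arc_interval_interior Et Et'
         (introT andP (conj tv (lt_le_trans vu ut')))); apply.
  by move/eqP: inc; rewrite (inj_eq (addIr _)) => /eqP.
have hy u i : t <= u <= t' -> bcast (arc_val q u j) i = bcast p i.
  move=> tu; rewrite /bcast (step 1 _ u i tu).
    by rewrite -[LHS]/(bcast _ i) packE.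
  by move=> v k _; rewrite !mxE.
have hz u i : t <= u <= t' ->
    zhat Gr (arc_val q u j) i = zhat Gr (flow Gr sigma (u - t) p) i.
  by move=> tu; rewrite zhat_flow; apply: eq_zhat => k; exact: hy.
have hf u i : t <= u <= t' ->
    phihat Gr (arc_val q u j) i = phihat Gr (flow Gr sigma (u - t) p) i.
  by move=> tu; rewrite phihat_flow; apply: eq_phihat => k; exact: hy.
have hx u i : t <= u <= t' ->
    phys (arc_val q u j) i = phys (flow Gr sigma (u - t) p) i.
  move=> tu; apply: (step 0 _ u i tu) => v k /andP[tv vt'].
  by rewrite !mxE/= hz// !ltW.
have he u i : t <= u <= t' ->
    err (arc_val q u j) i = err (flow Gr sigma (u - t) p) i.
  by move=> tu; rewrite /err hx// hy// bcast_flow.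
have t't : t <= t' <= t' by rewrite tt' lexx.
apply: state_eqP => i; [exact: hx | by rewrite hy// bcast_flow |].
apply: (step 2 _ t' i t't) => v k /andP[tv vt'].
by rewrite !mxE/= hf ?hz ?he// !ltW.
Qed.

Lemma arc_jump t j : E (t, j) -> E (t, j.+1) -> exists k,
  triggered (arc_val q t j) k /\
  arc_val q t j.+1 = broadcast k (arc_val q t j).
Proof. by have [_ _ + _] := hq; apply. Qed.

Lemma start_domain : E (0, 0%N).
Proof. by have [[_ [] ]] := hq. Qed.

(** Along an interval of flow chi is a polynomial, nonnegative before the right
    endpoint, hence also there; jumps do not change chi. *)
Lemma clock_ge0 t j i : E (t, j) -> 0 <= clock (arc_val q t j) i.
Proof.
move=> Et; pose P t j := 0 <= clock (arc_val q t j) i.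
have [[_ _ _ ode _] init _ _] := hq.
apply: (hybrid_ind solution_domain (P := P) start_domain) (Et) _ _ => //.
- by rewrite /P (init i).2.
- move=> {Et}s s' l Es Es' _ _ ss' _; rewrite /P (arc_flow Es Es' (ltW ss')).
  set p := arc_val q s l.
  have cv := @continuous_flow s p i 2 s'.
  apply: (@cvgr_to_ge _ _ _ _ _ _ _ (cvg_at_left_filter cv)).
  near=> u.
  have su : s < u < s' by apply/andP; split; near: u;
    [exact: nbhs_left_gt | exact: nbhs_left_lt].
  have Eu := time_convex solution_domain Es Es' (_ : s <= u <= s').
  have [/(_ i) + _] := ode _ _ (arc_interval_interior Es Es' su).
  have /andP[su1 us'] := su; rewrite !ltW// in Eu.
  by rewrite (arc_flow Es (Eu isT) (ltW su1)).
- move=> {Et}s l Es Es' _ _; rewrite /P.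
  by have [k [_ ->]] := arc_jump Es Es'; rewrite clock_broadcast.
- exact: (time_ge0 solution_domain Et).
Unshelve. all: by end_near. Qed.

Lemma energy_ge0 t j i : E (t, j) -> 0 <= energy (arc_val q t j) i.
Proof. by move=> Et; rewrite addr_ge0 ?sqr_ge0 ?clock_ge0. Qed.

End Solutions.

(** * Inter-event times *)

Section Dwell.
Variables (R : realType) (N : nat) (Gr : wdigraph R N) (sigma : 'I_N -> R).
Hypothesis hbal : weight_balanced Gr.
Hypothesis hsigma : forall i, 0 < sigma i < 1.
Variable q : hybrid_arc R N 3.
Hypothesis hq : algorithm_solution Gr sigma q.
Implicit Types (i k : 'I_N) (t s a : R) (j : nat).
Local Notation E := (arc_dom q).
Local Notation Edom := (solution_domain hq).
Local Notation V t j := (lyapunov (arc_val q t j)).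

Lemma lyapunov_nonincreasing a j0 t j :
  E (a, j0) -> E (t, j) -> a <= t -> (j0 <= j)%N -> V t j <= V a j0.
Proof.
move=> Ea Et; apply: (hybrid_ind Edom (P := fun t j => V t j <= V a j0) Ea) Et.
- exact: lexx.
- move=> s s' l Es Es' _ _ ss'; apply: le_trans.
  rewrite (arc_flow hq Es Es' (ltW ss')) lyapunov_flow// lerBlDr lerDl.
  by rewrite mulr_ge0 ?dissipation_ge0// subr_ge0 ltW.
- move=> s l Es Es' _ _; have [k [_ ->]] := arc_jump hq Es Es'.
  by rewrite lyapunov_broadcast.
Qed.

(** The base point (a, j0) is the start or follows an event of agent i, and [t0]
    is the time of its last event, or a if there is none after the base point.
    Jumps of other agents do not affect the first inequality, those of agent i
    reset both sides of it to 0.  The second one holds because the energy grows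
    at the rate [sigma_i phihat_i] while V decreases at least at the rate
    [(1 - sigma_i) phihat_i]. *)
Lemma since_last_broadcast i a j0 t j : E (a, j0) ->
    clock (arc_val q a j0) i = 0 -> err (arc_val q a j0) i = 0 ->
    E (t, j) -> a <= t -> (j0 <= j)%N ->
  (exists2 t0, a <= t0 <= t &
     sigma i * err (arc_val q t j) i ^+ 2
       <= out_degree Gr i * (t - t0) * energy (arc_val q t j) i) /\
  (1 - sigma i) * energy (arc_val q t j) i <= sigma i * (V a j0 - V t j).
Proof.
move=> Ea c0 e0; have /andP[s0 s1] := hsigma i.
pose P t j := (exists2 t0, a <= t0 <= t &
     sigma i * err (arc_val q t j) i ^+ 2
       <= out_degree Gr i * (t - t0) * energy (arc_val q t j) i) /\
  (1 - sigma i) * energy (arc_val q t j) i <= sigma i * (V a j0 - V t j).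
move: t j; apply: (hybrid_ind Edom (P := P) Ea).
- split; first by exists a; rewrite ?lexx// e0 subrr expr0n !(mulr0, mul0r).
  by rewrite /energy c0 e0 expr0n addr0 subrr !mulr0.
- move=> t t' j Et Et' at_ j0j tt' [[t0 /andP[at0 t0t] H1] H2].
  have h0 : 0 <= t' - t by rewrite subr_ge0 ltW.
  split.
    exists t0; first by rewrite at0 (le_trans t0t (ltW tt')).
    have -> : t' - t0 = (t - t0) + (t' - t) by ring.
    rewrite (arc_flow hq Et Et' (ltW tt')).
    apply: err_bound_flow => //; first by rewrite subr_ge0.
    exact: (energy_ge0 hq i Et).
  rewrite (arc_flow hq Et Et' (ltW tt')) lyapunov_flow// energy_flow.
  set p := arc_val q t j in H2 *.
  have := ler_wpM2l h0 (dissipation_ge Gr hsigma p i).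
  move/(ler_wpM2l (ltW s0)); move: H2.
  move: (\sum_k _) (t' - t) (phihat _ _ _) (energy _ _) (lyapunov _) => *.
  lra.
- move=> t j Et Et' at_ j0j [[t0 /andP[at0 t0t] H1] H2].
  have [k [[ck _] qk]] := arc_jump hq Et Et'.
  rewrite /P qk /energy lyapunov_broadcast clock_broadcast err_broadcast.
  case: eqP => [ik|_]; last by split=> //; exists t0; rewrite ?at0.
  rewrite ik ck expr0n addr0 !mulr0; split.
    by exists t; rewrite ?lexx ?at_ ?mulr0.
  apply: mulr_ge0; first by rewrite -ik ltW.
  by rewrite subr_ge0; exact: lyapunov_nonincreasing.
Qed.

(** At an event the energy is the square of the error, and the invariant
    bounds the elapsed time from below by [sigma / d]. *)
Lemma min_inter_event_time i a j0 t j : E (a, j0) ->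
    clock (arc_val q a j0) i = 0 -> err (arc_val q a j0) i = 0 ->
    E (t, j) -> a <= t -> (j0 <= j)%N -> triggered (arc_val q t j) i ->
  sigma i <= out_degree Gr i * (t - a).
Proof.
move=> Ea c0 e0 Et at_ j0j [ct bt].
have [[t0 /andP[at0 t0t] +] _] := since_last_broadcast Ea c0 e0 Et at_ j0j.
rewrite /energy ct add0r.
have e2 : 0 < err (arc_val q t j) i ^+ 2.
  by rewrite exprn_even_gt0//= /err subr_eq0; apply/eqP => /esym.
rewrite ler_pM2r// => /le_trans; apply.
by rewrite ler_wpM2l ?out_degree_ge0// lerB.
Qed.

(** At an event the energy is the square of the error, which the second invariant
    bounds by the decrease of the Lyapunov function. *)
Lemma event_error i a j0 t j : E (a, j0) ->
    clock (arc_val q a j0) i = 0 -> err (arc_val q a j0) i = 0 ->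
    E (t, j) -> a <= t -> (j0 <= j)%N -> triggered (arc_val q t j) i ->
  (1 - sigma i) * err (arc_val q t j) i ^+ 2 <= V a j0 - V t j.
Proof.
move=> Ea c0 e0 Et at_ j0j [ct bt].
have [_] := since_last_broadcast Ea c0 e0 Et at_ j0j.
rewrite /energy ct add0r => /le_trans; apply.
have /andP[s0 s1] := hsigma i.
by rewrite ler_piMl ?(ltW s1)// subr_ge0; exact: lyapunov_nonincreasing.
Qed.

(** By min_inter_event_time, such a tau bounds the inter-event times of all
    agents from below. *)
Lemma dwell_time_ex :
  exists2 tau : R, 0 < tau & forall i, out_degree Gr i * tau < sigma i.
Proof.
apply: finite_pos_lb => i.
  by move=> x y x0 xy; apply: le_lt_trans; rewrite ler_wpM2l ?out_degree_ge0.
have /andP[s0 _] := hsigma i.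
have d0 := out_degree_ge0 Gr i.
exists (sigma i / (out_degree Gr i + 1)).
  by rewrite divr_gt0// ltr_wpDl.
rewrite mulrA ltr_pdivrMr ?ltr_wpDl// mulrC ltr_pM2l//.
by rewrite ltrDl.
Qed.

Variable tau : R.
Hypothesis tau_lt : forall i, out_degree Gr i * tau < sigma i.

(** Among N + 1 jumps two are made by the same agent. *)
Lemma many_jumps_take_time t j t' j' :
  E (t, j) -> E (t', j') -> (j + N < j')%N -> t + tau <= t'.
Proof.
move=> Et Et' jj'.
pose event (l : 'I_N.+1) (x : 'I_N * R) :=
  [/\ E (x.2, (j + l)%N), E (x.2, (j + l).+1),
    triggered (arc_val q x.2 (j + l)%N) x.1 &
    arc_val q x.2 (j + l).+1 = broadcast x.1 (arc_val q x.2 (j + l)%N)].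
have /choice[f fP] : forall l, exists x, event l x.
  move=> l.
  have lj' : (j + l < j')%N.
    by apply: leq_ltn_trans jj'; rewrite leq_add2l -ltnS ltn_ord.
  have [s [_ Es Es']] := jump_time Edom lj' Et'.
  by have [k [tk qk]] := arc_jump hq Es Es'; exists (k, s).
have [l [l' [ll' fl]]] : exists l l' : 'I_N.+1,
    (l < l')%N /\ (f l).1 = (f l').1.
  have /injectivePn[l [l' nll' fl]] : ~~ injectiveb (fun l => (f l).1).
    apply/negP => /injectiveP /leq_card.
    by rewrite !card_ord ltnn.
  have [ll'|l'l|/val_inj ll'] := ltngtP l l'.
  - by exists l, l'.
  - by exists l', l.
  - by rewrite ll' eqxx in nll'.
have [El El1 [cl _] ql] := fP l.
have [El' El'1 tl' _] := fP l'.
rewrite -fl in tl'.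
have tl : t <= (f l).2.
  by apply: (time_mono Edom _ Et El1); rewrite ltnS leq_addr.
have lt' : (f l').2 <= t'.
  apply: (time_mono Edom _ El' Et').
  by apply: leq_ltn_trans jj'; rewrite leq_add2l -ltnS ltn_ord.
have ll1 : ((j + l).+1 <= j + l')%N by rewrite ltn_add2l.
have lel : (f l).2 <= (f l').2.
  by apply: (time_mono Edom _ El El'); rewrite ltn_add2l.
have := @min_inter_event_time (f l).1 _ _ _ _ El1 _ _ El' lel ll1 tl'.
rewrite ql clock_broadcast err_broadcast eqxx => /(_ cl erefl) key.
have : tau <= (f l').2 - (f l).2.
  rewrite leNgt; apply/negP => /ltW.
  move/(ler_wpM2l (out_degree_ge0 Gr (f l).1)).
  by rewrite leNgt (lt_le_trans (tau_lt (f l).1) key).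
lra.
Qed.

Lemma jumps_unbounded_time m t j :
  E (t, j) -> (m * N.+1 <= j)%N -> m%:R * tau <= t.
Proof.
elim: m t j => [|m IH] t j Et; first by rewrite mul0r (time_ge0 Edom Et).
rewrite mulSn => mj.
have [s [_ Es]] := level_time Edom (leq_trans (leq_addl _ _) mj) Et.
have := IH _ _ Es (leqnn _).
have : s + tau <= t by apply: (many_jumps_take_time Es Et); rewrite -addnS addnC.
by rewrite -[in X in _ -> _ -> X]addn1 natrD; lra.
Qed.

End Dwell.

(** * Maximal solutions exist for all time *)

Section Extension.
Variables (R : realType) (N : nat) (Gr : wdigraph R N) (sigma : 'I_N -> R).
Hypothesis hsigma : forall i, 0 < sigma i < 1.
Implicit Types (i k : 'I_N) (t s a : R) (j : nat) (p : 'M[R]_(N, 3)).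
Local Notation flow := (flow Gr sigma).

Definition can_flow p : Prop :=
  (forall i, 0 <= clock p i) /\ (forall i, ~ triggered p i).

(** A positive clock stays positive for a while by continuity.  A zero clock
    goes with a zero error, and then the clock grows like
    [h (sigma phihat - h zhat ^ 2)], which is positive for small h unless phihat
    vanishes; in that case zhat vanishes as well and the error stays 0. *)
Lemma can_flow_for_a_while p :
    can_flow p ->
  exists2 d : R, 0 < d & forall h, 0 <= h <= d -> can_flow (flow h p).
Proof.
move=> [cp tp].
suff [d d0 dP] : exists2 d : R, 0 < d & forall i h, 0 <= h <= d ->
    0 <= clock (flow h p) i /\ ~ triggered (flow h p) i.
  by exists d => // h hd; split=> i; have [] := dP i h hd.
apply: finite_pos_lb => i.
  move=> x y x0 xy H h /andP[h0 hx]; apply: H.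
  by rewrite h0 (le_trans hx).
have /andP[s0 _] := hsigma i.
have d0 := out_degree_ge0 Gr i.
set z := zhat Gr p i; set f := phihat Gr p i; set e := err p i.
have f0 : 0 <= f := phihat_ge0 Gr p i.
have [c0|c1] := eqVneq (clock p i) 0.
  have e0 : e = 0.
    apply/eqP; rewrite subr_eq0; apply/eqP; apply: contrapT => ne.
    by apply: (tp i); split=> // /esym.
  exists (sigma i / (out_degree Gr i + 1)).
    by rewrite divr_gt0// ltr_wpDl.
  move=> h /andP[h0]; rewrite ler_pdivlMr ?ltr_wpDl// => hd.
  have cE : clock (flow h p) i = h * (sigma i * f - h * z ^+ 2).
    by rewrite packE c0 -/e e0 -/f -/z; ring.
  have zf : z ^+ 2 <= out_degree Gr i * f := zhat_sqr_le Gr p i.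
  have [->|h1] := eqVneq h 0.
    by rewrite flow0; split; [exact: cp | exact: tp].
  have {h1}h0 : 0 < h by rewrite lt_def h1.
  have slack : h * f <= sigma i * f - h * z ^+ 2.
    have := ler_wpM2r f0 hd; have := ler_wpM2l (ltW h0) zf; lra.
  have hf : 0 <= h * f by rewrite mulr_ge0// ltW.
  split; first by rewrite cE mulr_ge0 ?(ltW h0)// (le_trans hf).
  move=> [+ ne]; rewrite cE => /eqP; rewrite mulf_eq0 gt_eqF//= => /eqP c1.
  have f1 : f = 0.
    by apply/le_anti; rewrite f0 andbT; move: slack; rewrite c1 pmulr_rle0.
  have z0 : z = 0.
    by apply/eqP; rewrite -sqrf_eq0; apply/eqP/le_anti; rewrite sqr_ge0 andbT;
       move: zf; rewrite f1 mulr0.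
  apply: ne; apply/esym/eqP; rewrite -subr_eq0 -/(err _ _) err_flow.
  by rewrite -/e -/z e0 z0; apply/eqP; ring.
have cgt0 : 0 < clock p i by rewrite lt_def c1 cp.
set c := clock p i in c1 cgt0.
set g := sigma i * f + 2 * e * z.
have K0 : 0 < 1 + `|g| + z ^+ 2.
  by have := normr_ge0 g; have := sqr_ge0 z; lra.
exists (Num.min 1 (c / (2 * (1 + `|g| + z ^+ 2)))).
  by rewrite lt_min ltr01 divr_gt0// mulr_gt0.
move=> h /andP[h0]; rewrite le_min => /andP[h1].
rewrite ler_pdivlMr ?mulr_gt0// => hc.
have cpos : 0 < clock (flow h p) i.
  rewrite packE -/c -/f -/e -/z -/g.
  have : - (h * g) <= h * `|g|.
    by rewrite -mulrN ler_wpM2l// -normrN ler_norm.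
  have : h ^+ 2 * z ^+ 2 <= h * z ^+ 2.
    by rewrite ler_wpM2r ?sqr_ge0// expr2 ler_piMl.
  have : 0 <= h * `|g| by rewrite mulr_ge0.
  have : 0 <= h * z ^+ 2 by rewrite mulr_ge0// sqr_ge0.
  lra.
by split; [exact: ltW | move=> [c2 _]; rewrite c2 ltxx in cpos].
Qed.

Lemma interior_lt (A : set R) t b : A° t -> (forall u, A u -> u <= b) -> t < b.
Proof.
move=> /nbhs_ballP[e /= e0 sub] ub.
apply: (@lt_le_trans _ _ (t + e / 2)); first by rewrite ltrDl divr_gt0.
apply/ub/sub; rewrite /ball/= opprD addNKr normrN gtr0_norm ?divr_gt0//.
by rewrite ltr_pdivrMr// ltr_pMr// ltr1n.
Qed.

Variable q : hybrid_arc R N 3.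
Hypothesis hq : algorithm_solution Gr sigma q.
Local Notation E := (arc_dom q).
Local Notation Edom := (solution_domain hq).

Variable J : nat.
Hypothesis last_level : forall t j, E (t, j) -> (j <= J)%N.

(** The flow issued from the start s of the last level describes the solution on
    all of that level, old and new, so that the extension is differentiable at
    the former end of the level too. *)
Lemma extend_by_flow s T : E (s, J) -> s <= T ->
    (J = 0%N -> s = 0) -> (forall j, J = j.+1 -> E (s, j)) ->
    (forall t, E (t, J) -> s <= t <= T) ->
    (forall t, s <= t < T -> can_flow (flow (t - s) (arc_val q s J))) ->
  exists q', [/\ algorithm_solution Gr sigma q', extends q q' &
    arc_dom q' (T, J)].
Proof.
move=> Es sT J0 JS EJ cf.
pose q' := HybridArc (E `|` [set x | x.2 = J /\ s <= x.1 <= T])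
  (fun t j => if j == J then flow (t - s) (arc_val q s J) else arc_val q t j).
have val t j : E (t, j) -> arc_val q' t j = arc_val q t j.
  move=> Et /=; case: eqP => // jJ; rewrite jJ in Et *.
  by rewrite (arc_flow hq Es Et)//; have /andP[] := EJ _ Et.
have domJ t : arc_dom q' (t, J) <-> s <= t <= T.
  by split=> [[/EJ//|[]//]|st]; right.
have domN t j : j != J -> arc_dom q' (t, j) <-> E (t, j).
  by move=> jJ; split=> [[//|[/= jJ']]|]; [rewrite jJ' eqxx in jJ | left].
have consec t j : arc_dom q' (t, j) -> arc_dom q' (t, j.+1) ->
    E (t, j) /\ E (t, j.+1).
  have [->|jJ] := eqVneq j J.
    by move=> _ /domN; rewrite gtn_eqF// => /(_ isT)/last_level; rewrite ltnn.
  move/(domN _ _ jJ) => Et; have [jJ'|jJ'] := eqVneq j.+1 J; last first.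
    by move/(domN _ _ jJ').
  rewrite jJ' => /domJ/andP[st _]; split=> //.
  suff -> : t = s by [].
  apply/le_anti; rewrite st andbT.
  by apply: (time_mono Edom _ Et Es); rewrite -jJ'.
have int j : j != J -> arc_interval q' j = arc_interval q j.
  by move=> jJ; apply/seteqP; split=> t /domN => /(_ jJ).
have [[_ [_ st0] cont ode jmpH] init jmp imm] := hq.
have [E0 ES Elt] := Edom.
exists q'; split; last 2 first.
- by split=> // x; left.
- by apply/domJ; rewrite sT lexx.
split.
- split.
  + apply: linear_hybrid_time_domain; split.
    * move=> t; have [J0'|J0'] := eqVneq 0%N J.
        have := domJ; rewrite -J0' (J0 (esym J0')) => dom0.
        move=> /dom0/andP[t0 tT]; split=> // u /andP[u0 ut]; apply/dom0.
        by rewrite u0 (le_trans ut).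
      move=> /(domN _ _ J0')/E0[t0 Eu]; split=> // u /Eu.
      by move/(domN _ _ J0').
    * move=> t j; have [jJ|jJ] := eqVneq j.+1 J.
        rewrite jJ => /domJ/andP[st tT]; exists s; split=> //.
          by left; apply: JS.
        by move=> u /andP[su ut]; apply/domJ; rewrite su (le_trans ut).
      move=> /(domN _ _ jJ)/ES[u [ut Eu Eut]]; exists u; split=> //.
        by left.
      by move=> v /Eut; left.
    * move=> t j t' j' jj'; have [jJ|jJ] := eqVneq j' J.
        rewrite jJ in jj' * => /domN; rewrite ltn_eqF// => /(_ isT) Et.
        by move=> /domJ/andP[+ _]; apply: le_trans; exact: Elt Et Es.
      move=> + /(domN _ _ jJ) Et'; have [jJ'|jJ'] := eqVneq j J.
        by move: (leq_trans jj' (last_level Et')); rewrite jJ' ltnn.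
      by move=> /(domN _ _ jJ') Et; exact: Elt Et Et'.
  + split; first by left; exact: (start_domain hq).
    by rewrite val//; exact: (start_domain hq).
  + move=> j i c; have [->|jJ] := eqVneq j J.
      rewrite /= eqxx; apply: continuous_subspaceT; exact: continuous_flow.
    by rewrite int//= (negbTE jJ); exact: cont.
  + move=> j t; have [->|jJ] := eqVneq j J.
      move=> it; rewrite /= eqxx; split.
        apply: (cf t _).1; rewrite (interior_lt it) ?andbT.
          by have /domJ/andP[] := interior_subset it.
        by move=> u /domJ/andP[].
      by move=> i c; exact: is_derive_flow.
    by rewrite int//= (negbTE jJ) => it; exact: ode.
  + move=> t j Et Et'; have [{}Et {}Et'] := consec _ _ Et Et'.
    by rewrite !val//; exact: jmpH.
- by rewrite val; [exact: init | exact: (start_domain hq)].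
- move=> t j Et Et'; have [{}Et {}Et'] := consec _ _ Et Et'.
  by rewrite !val//; exact: jmp.
- move=> t j i; have [->|jJ] := eqVneq j J.
    move=> /domJ/andP[st tT] trig t' /domJ/andP[_ t'T]; apply: (le_trans t'T).
    rewrite leNgt; apply/negP => tT'.
    have [_ /(_ i)] : can_flow (flow (t - s) (arc_val q s J)).
      by apply: cf; rewrite st.
    by apply; move: trig; rewrite /= eqxx.
  move=> /(domN _ _ jJ) Et trig t' /(domN _ _ jJ) Et'.
  by apply: (imm _ _ i Et _ _ Et'); move: trig; rewrite val.
Qed.

Lemma extend_by_jump T k : E (T, J) -> (forall t j, E (t, j) -> t <= T) ->
    triggered (arc_val q T J) k ->
  exists q', [/\ algorithm_solution Gr sigma q', extends q q' &
    arc_dom q' (T, J.+1)].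
Proof.
move=> ET Tmax trig.
pose q' := HybridArc (E `|` [set (T, J.+1)])
  (fun t j => if j == J.+1 then broadcast k (arc_val q T J) else arc_val q t j).
have val t j : E (t, j) -> arc_val q' t j = arc_val q t j.
  by move=> Et /=; rewrite ltn_eqF// ltnS (last_level Et).
have domJ t : arc_dom q' (t, J.+1) <-> t = T.
  by split=> [[/last_level|[//]]|->]; [rewrite ltnn | right].
have domN t j : j != J.+1 -> arc_dom q' (t, j) <-> E (t, j).
  move=> jJ; split=> [[//|[_ jJ']]|]; last by left.
  by rewrite jJ' eqxx in jJ.
have consec t j : arc_dom q' (t, j) -> arc_dom q' (t, j.+1) ->
    E (t, j) /\ (E (t, j.+1) \/ t = T /\ j = J).
  have [->|jJ] := eqVneq j J.+1.
    move=> _ /domN; rewrite gtn_eqF// => /(_ isT)/last_level/ltnW.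
    by rewrite ltnn.
  move/(domN _ _ jJ) => Et Et'; split=> //.
  by case: Et' => [|[-> ->]]; [left | right].
have int j : j != J.+1 -> arc_interval q' j = arc_interval q j.
  by move=> jJ; apply/seteqP; split=> t /domN => /(_ jJ).
have [[_ [_ st0] cont ode jmpH] init jmp imm] := hq.
have [E0 ES Elt] := Edom.
have valJ : arc_val q' T J.+1 = broadcast k (arc_val q' T J).
  by rewrite (val _ _ ET) /= ?eqxx.
exists q'; split; last 2 first.
- by split=> // x; left.
- exact/domJ.
split.
- split.
  + apply: linear_hybrid_time_domain; split.
    * move=> t /(domN _ 0%N isT)/E0[t0 Eu]; split=> // u /Eu.
      by move/(domN _ 0%N isT).
    * move=> t j; have [jJ|jJ] := eqVneq j J.
        rewrite jJ => /domJ ->; exists T; split=> //; first by left.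
        by move=> u uT; apply/domJ/le_anti; rewrite andbC.
      move=> /(domN _ j.+1 jJ)/ES[u [ut Eu Eut]]; exists u; split=> //.
        by left.
      by move=> v /Eut; left.
    * move=> t j t' j' jj'; have [jJ|jJ] := eqVneq j' J.+1.
        rewrite jJ in jj' * => /domN; rewrite ltn_eqF// => /(_ isT) Et.
        by move=> /domJ ->; exact: Tmax Et.
      move=> + /(domN _ _ jJ) Et'; have [jJ'|jJ'] := eqVneq j J.+1.
        by move: (leq_trans jj' (last_level Et')); rewrite jJ' ltnNge leqnSn.
      by move=> /(domN _ _ jJ') Et; exact: Elt Et Et'.
  + split; first by left; exact: (start_domain hq).
    by rewrite val//; exact: (start_domain hq).
  + move=> j i c; have [->|jJ] := eqVneq j J.+1.
      by rewrite /= eqxx; apply: continuous_subspaceT => x; exact: cvg_cst.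
    by rewrite int//= (negbTE jJ); exact: cont.
  + move=> j t; have [->|jJ] := eqVneq j J.+1.
      move=> it; exfalso; have /domJ tT := interior_subset it.
      suff : t < T by rewrite tT ltxx.
      by apply: interior_lt it _ => u /domJ ->.
    by rewrite int//= (negbTE jJ) => it; exact: ode.
  + move=> t j Et Et'; have [{}Et [{}Et'|[tT jJ]]] := consec _ _ Et Et'.
      by rewrite !val//; exact: jmpH.
    rewrite tT jJ valJ val//; have [ck _] := trig.
    by split; exists k; rewrite /et_jump_set_of/= ck.
- by rewrite val; [exact: init | exact: (start_domain hq)].
- move=> t j Et Et'; have [{}Et [{}Et'|[tT jJ]]] := consec _ _ Et Et'.
    by rewrite !val//; exact: jmp.
  by rewrite tT jJ valJ val//; exists k.
- move=> t j i; have [->|jJ] := eqVneq j J.+1.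
    by move=> /domJ -> _ t' /domJ ->.
  move=> /(domN _ _ jJ) Et trig' t' /(domN _ _ jJ) Et'.
  by apply: (imm _ _ i Et _ _ Et'); move: trig'; rewrite val.
Qed.

End Extension.

Section Completeness.
Variables (R : realType) (N : nat) (Gr : wdigraph R N) (sigma : 'I_N -> R).
Hypothesis hbal : weight_balanced Gr.
Hypothesis hsigma : forall i, 0 < sigma i < 1.
Variable q : hybrid_arc R N 3.
Hypothesis hq : trajectory Gr sigma q.
Local Notation E := (arc_dom q).

Let hsol : algorithm_solution Gr sigma q := hq.1.
Local Notation Edom := (solution_domain hsol).

(** By the dwell time, a bound on the times bounds the number of jumps. *)
Lemma trajectory_last_level T : (forall t j, E (t, j) -> t <= T) ->
  exists2 J, (exists t, E (t, J)) & forall t j, E (t, j) -> (j <= J)%N.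
Proof.
move=> ub; have [tau tau0 tauP] := dwell_time_ex Gr hsigma.
pose P j := `[< exists t, E (t, j) >].
have exP : exists j, P j.
  by exists 0%N; apply/asboolP; exists 0; exact: (start_domain hsol).
pose m := (Num.truncn (T / tau)).+1.
have bd j : P j -> (j <= m * N.+1)%N.
  move=> /asboolP[t Et]; rewrite leqNgt; apply/negP => /ltnW mj.
  have := jumps_unbounded_time hbal hsigma hsol tauP Et mj.
  rewrite leNgt (le_lt_trans (ub _ _ Et))// -ltr_pdivrMr//.
  exact: truncnS_gt.
case: (ex_maxnP exP bd) => J /asboolP PJ Jmax.
by exists J => // t j Et; apply: Jmax; apply/asboolP; exists t.
Qed.

(** Otherwise there are finitely many jumps, and after the last of them the
    solution could be continued: up to the supremum of its times if this is not
    attained; there by a jump if some agent is triggered; else by a flow. *)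
Lemma trajectory_complete T0 : exists t j, E (t, j) /\ T0 <= t.
Proof.
apply: contrapT => no.
have ub t j : E (t, j) -> t <= T0.
  move=> Et; rewrite leNgt; apply/negP => T0t; apply: no.
  by exists t, j; split=> //; exact: ltW.
have [J [u Eu] Jmax] := trajectory_last_level ub.
have [q_sol q_max] := hq.
have maxE q' t j : algorithm_solution Gr sigma q' -> extends q q' ->
    arc_dom q' (t, j) -> E (t, j).
  by move=> sol' ext; exact: q_max.
have [s [Es s0 sS smin]] : exists s, [/\ E (s, J), J = 0%N -> s = 0,
    (forall j, J = j.+1 -> E (s, j)) & forall t, E (t, J) -> s <= t].
  case: J Eu {Jmax} => [|J] Eu.
    exists 0; split=> //; first exact: (start_domain hsol).
    by move=> t; exact: (time_ge0 Edom).
  have [s [_ Es Es']] := jump_time Edom (ltnSn J) Eu.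
  exists s; split=> // [j [<-]//|t].
  exact: (time_mono Edom (ltnSn J) Es).
pose I := [set t | E (t, J)].
have supI : has_sup I by split; [exists s | exists T0 => t /ub].
pose T := sup I.
have IT t : E (t, J) -> t <= T by move=> It; exact: (sup_upper_bound supI).
have sT : s <= T by exact: IT.
have early t : E (t, J) -> (exists2 t', E (t', J) & t < t') ->
    can_flow (flow Gr sigma (t - s) (arc_val q s J)).
  move=> Et [t' Et' tt']; rewrite -(arc_flow hsol Es Et) ?smin//.
  split=> i; first exact: (clock_ge0 hsol).
  move=> trig; have [_ _ _ imm] := hsol.
  by have := imm _ _ i Et trig _ Et'; rewrite leNgt tt'.
have [ET|nET] := pselect (E (T, J)); last first.
  have [||q' [sol' ext ET]] := extend_by_flow hsol Jmax Es sT s0 sS.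
  - by move=> t Et; rewrite smin// IT.
  - move=> t /andP[st tT].
    have Tt : 0 < T - t by rewrite subr_gt0.
    have [t' It' tt'] := sup_adherent Tt supI.
    rewrite -/T opprB addrCA subrr addr0 in tt'.
    apply: early; last by exists t'.
    by apply: (time_convex Edom Es It'); rewrite st ltW.
  - by apply: nET; exact: (maxE q').
have [[k trig]|ntrig] := pselect (exists k, triggered (arc_val q T J) k).
  have [|q' [sol' ext ET']] := extend_by_jump hsol Jmax ET _ trig.
    move=> t j Et; have := Jmax _ _ Et; rewrite leq_eqVlt => /predU1P[jJ|jJ].
      by apply: IT; rewrite -jJ.
    exact: (time_mono Edom jJ Et ET).
  by have := Jmax _ _ (maxE _ _ _ sol' ext ET'); rewrite ltnn.
have cfT : can_flow (arc_val q T J).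
  by split=> i; [exact: (clock_ge0 hsol) | move=> ti; apply: ntrig; exists i].
have [d d0 cfd] := can_flow_for_a_while Gr hsigma cfT.
have Td : T <= T + d by rewrite lerDl ltW.
have [||q' [sol' ext ET']] :=
  extend_by_flow hsol Jmax Es (le_trans sT Td) s0 sS.
- by move=> t Et; rewrite smin//= (le_trans (IT _ Et)).
- move=> t /andP[st tT]; have [tltT|Tt] := ltP t T.
    apply: early; last by exists T.
    by apply: (time_convex Edom Es ET); rewrite st ltW.
  have -> : t - s = (T - s) + (t - T) by ring.
  rewrite -flowD -(arc_flow hsol Es ET sT).
  by apply: cfd; rewrite subr_ge0 Tt/= lerBlDl ltW.
- have := IT _ (maxE _ _ _ sol' ext ET').
  by rewrite gerDl leNgt d0.
Qed.

End Completeness.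

(** * Convergence to consensus of the broadcast states *)

Section Convergence.
Variables (R : realType) (N : nat) (Gr : wdigraph R N) (sigma : 'I_N -> R).
Hypothesis hbal : weight_balanced Gr.
Hypothesis hsigma : forall i, 0 < sigma i < 1.
Variable q : hybrid_arc R N 3.
Hypothesis hq : trajectory Gr sigma q.
Implicit Types (i k : 'I_N) (t : R) (j : nat).
Local Notation E := (arc_dom q).

Let hsol : algorithm_solution Gr sigma q := hq.1.
Local Notation Edom := (solution_domain hsol).
Local Notation V t j := (lyapunov (arc_val q t j)).

Lemma lyapunov_settles (eta : R) : 0 < eta ->
  exists T, forall t j t' j', E (t, j) -> E (t', j') -> T < t -> t <= t' ->
    (j <= j')%N -> V t j - V t' j' <= eta.
Proof.
move=> eta0; pose S := [set v : R | exists t j, E (t, j) /\ v = V t j].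
have Slb : lbound S 0.
  by move=> v [t [j [Et ->]]]; apply: lyapunov_ge0 => i; exact: (clock_ge0 hsol).
have infS : has_inf S.
  split; last by exists 0.
  by exists (V 0 0%N), 0, 0%N; split=> //; exact: (start_domain hsol).
have [v [a [j0 [Ea ->]]] Va] := inf_adherent eta0 infS.
exists a => t j t' j' Et Et' at_ tt' jj'.
have infle : inf S <= V t' j'.
  by apply: ge_inf; [exact: infS.2 | exists t', j'].
have j0j : (j0 <= j)%N.
  rewrite leqNgt; apply/negP => jj0.
  by have := time_mono Edom jj0 Et Ea; rewrite leNgt at_.
have := lyapunov_nonincreasing hbal hsigma hsol Ea Et (ltW at_) j0j.
lra.
Qed.

(** Either agent i stops broadcasting, or one of its late broadcasts serves as
    the base point from which the later ones are estimated. *)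
Lemma late_jumps_small i (eta : R) : 0 < eta ->
  exists T, forall t j, E (t, j) -> E (t, j.+1) -> T < t ->
    triggered (arc_val q t j) i ->
    arc_val q t j.+1 = broadcast i (arc_val q t j) ->
  err (arc_val q t j) i ^+ 2 <= eta.
Proof.
move=> eta0; have /andP[s0 s1] := hsigma i.
have s2 : 0 < 1 - sigma i by rewrite subr_gt0.
have [T TP] := lyapunov_settles (mulr_gt0 s2 eta0).
have [[a [j0 [Ea Ea' Ta ta qa]]]|none] := pselect (exists a j0,
    [/\ E (a, j0), E (a, j0.+1), T < a, triggered (arc_val q a j0) i &
      arc_val q a j0.+1 = broadcast i (arc_val q a j0)]); last first.
  by exists T => t j Et Et' Tt tt qt; exfalso; apply: none; exists t, j.
exists a => t j Et Et' at_ tt qt.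
have j0j : (j0.+1 <= j)%N.
  rewrite leqNgt; apply/negP => jj0.
  by have := time_mono Edom jj0 Et Ea'; rewrite leNgt at_.
have c0 : clock (arc_val q a j0.+1) i = 0.
  by rewrite qa clock_broadcast; case: ta.
have e0 : err (arc_val q a j0.+1) i = 0 by rewrite qa err_broadcast eqxx.
have := event_error hbal hsigma hsol Ea' c0 e0 Et (ltW at_) j0j tt.
have := TP _ _ _ _ Ea' Et Ta (ltW at_) j0j.
by move=> /[swap] /le_trans/[apply]; rewrite ler_pM2l.
Qed.

Local Notation gap i k t j :=
  (bcast (arc_val q t j) i - bcast (arc_val q t j) k).

Lemma gap_broadcast i k a p (d : R) : `|err p a| <= d ->
  `|(bcast (broadcast a p) i - bcast (broadcast a p) k)
     - (bcast p i - bcast p k)| <= 2 * d.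
Proof.
move=> ed; have d0 : 0 <= d := le_trans (normr_ge0 _) ed.
have one b : `|bcast (broadcast a p) b - bcast p b| <= d.
  rewrite bcast_broadcast; case: eqP => [->|_] //.
  by rewrite subrr normr0.
set y := bcast _ i in one *.
have := one i; have := one k.
rewrite -/y; move: (bcast _ k) (bcast p i) (bcast p k) => b c e h1 h2.
have -> : y - b - (c - e) = (y - c) - (b - e) by ring.
by apply: le_trans (ler_normB _ _) _; lra.
Qed.

(** A large late gap would persist for half a dwell time, since only boundedly
    many jumps, all of them small, occur meanwhile; the Lyapunov function would
    then decrease by a fixed amount. *)
Lemma gap_cvg i k (eps : R) : edge Gr i k -> 0 < eps ->
  exists T, forall t j, E (t, j) -> T < t -> `|gap i k t j| <= eps.
Proof.
move=> eik eps0; have [tau tau0 tauP] := dwell_time_ex Gr hsigma.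
have /andP[s0 s1] := hsigma i.
have w0 := weight_gt0 eik.
(* A jump of size d changes a difference of broadcast states by at most 2 d, so
   that N + 1 jumps change it by at most eps / 2. *)
pose d := eps / (4 * N.+1%:R).
have N0 : 0 < N.+1%:R :> R by rewrite ltr0n.
have d0 : 0 < d by rewrite divr_gt0// mulr_gt0.
(* The dissipation rate forced by a difference of at least eps / 2. *)
pose c := (1 - sigma i) * (weight Gr i k * (eps / 2) ^+ 2).
have c0 : 0 < c by rewrite !mulr_gt0 ?subr_gt0// exprn_gt0// divr_gt0.
have [T1 T1P] : exists T, forall a t j, E (t, j) -> E (t, j.+1) -> T < t ->
    triggered (arc_val q t j) a ->
    arc_val q t j.+1 = broadcast a (arc_val q t j) ->
    err (arc_val q t j) a ^+ 2 <= d ^+ 2.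
  apply: finite_ub => [a x y xy H t j Et Et' yt|a].
    by apply: H => //; exact: le_lt_trans yt.
  by apply: late_jumps_small; rewrite exprn_gt0.
have eta0 : 0 < c * (tau / 4) by rewrite mulr_gt0// divr_gt0.
have [T2 T2P] := lyapunov_settles eta0.
exists (Num.max T1 T2) => t j Et; rewrite gt_max => /andP[T1t T2t].
rewrite leNgt; apply/negP => big.
pose u := t + tau / 2.
have tu : t < u by rewrite ltrDl divr_gt0.
have [t2 [j2 [Et2 ut2]]] := trajectory_complete hbal hsigma hq u.
have [l [_ Eu]] : exists l, (l <= j2)%N /\ E (u, l).
  apply: (time_hit Edom Et2); rewrite ut2 andbT.
  exact: le_trans (time_ge0 Edom Et) (ltW tu).
have jl : (j <= l)%N.
  rewrite leqNgt; apply/negP => lj.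
  by have := time_mono Edom lj Eu Et; rewrite leNgt tu.
pose P t' j' := t' <= u ->
  `|gap i k t' j' - gap i k t j| <= 2 * d * (j' - j)%:R /\
  V t' j' <= V t j - (t' - t) * c.
have : P u l.
  apply: (hybrid_ind Edom (P := P) Et) (Eu) (ltW tu) jl.
  - by move=> _; rewrite subnn !subrr normr0 mulr0 mul0r subr0.
  - move=> s s' m Es Es' ts jm ss' IH s'u.
    have [IH1 IH2] := IH (le_trans (ltW ss') s'u).
    have few : (m - j <= N)%N.
      rewrite leqNgt; apply/negP => many.
      have jm' : (j + N < m)%N by move: many; rewrite ltn_subRL.
      have := many_jumps_take_time hbal hsigma hsol tauP Et Es jm'.
      by have := le_trans (ltW ss') s'u; rewrite /u; lra.
    rewrite (arc_flow hsol Es Es' (ltW ss')) !bcast_flow; split=> //.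
    rewrite lyapunov_flow//; set p := arc_val q s m in IH1 IH2 *.
    have gp : eps / 2 <= `|bcast p i - bcast p k|.
      have : 2 * d * (m - j)%:R <= eps / 2.
        have -> : eps / 2 = 2 * d * N.+1%:R.
          by rewrite /d; field; rewrite gt_eqF//= ltr0n.
        by rewrite ler_pM2l ?mulr_gt0// ler_nat (leq_trans few).
      have := lerB_dist (gap i k t j) (bcast p i - bcast p k).
      by rewrite distrC; lra.
    have cp : c <= (1 - sigma i) * phihat Gr p i.
      rewrite ler_pM2l ?subr_gt0//; apply: le_trans (phihat_edge p eik).
      rewrite ler_pM2l// -[leRHS]real_normK ?num_real//.
      by rewrite ler_pXn2r// ?nnegrE// ltW// divr_gt0.
    have ds : 0 <= s' - s by rewrite subr_ge0 ltW.
    have := ler_wpM2l ds (le_trans cp (dissipation_ge Gr hsigma p i)).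
    move: IH2; move: (\sum__ _) => D; lra.
  - move=> s m Es Es' ts jm IH su; have [IH1 IH2] := IH su.
    have [a [ta qa]] := arc_jump hsol Es Es'.
    rewrite qa lyapunov_broadcast; split=> //.
    have ea : `|err (arc_val q s m) a| <= d.
      rewrite -(ler_pXn2r (n := 2))// ?nnegrE ?(ltW d0)//.
      rewrite real_normK ?num_real//.
      by apply: T1P Es Es' _ ta qa; exact: lt_le_trans ts.
    have := gap_broadcast i k ea.
    rewrite subSn// -natr1.
    set y := _ - bcast (broadcast _ _) k; set z := gap i k s m in IH1 *.
    have := ler_normD (y - z) (z - gap i k t j).
    by rewrite addrA subrK; lra.
move=> /(_ (lexx u))[_].
have := T2P _ _ _ _ Et Eu T2t (ltW tu) jl.
by move: eta0; rewrite /u; lra.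
Qed.

End Convergence.

Lemma connect_gap (R : realType) (I : finType) (e : rel I) (i k : I) :
    connect e i k ->
  exists M : R, forall (y : I -> R) (b : R), 0 <= b ->
    (forall a c, e a c -> `|y a - y c| <= b) -> `|y i - y k| <= M * b.
Proof.
move=> /connectP[s si ->]; exists (size s)%:R => y b b0 yb.
elim: s i si => [|a s IH] i /=; first by rewrite subrr normr0 mul0r.
move=> /andP[ia sa]; have := ler_normD (y i - y a) (y a - y (last a s)).
rewrite subrKA => /le_trans; apply.
by rewrite -natr1 mulrDl mul1r addrC lerD// ?yb// IH.
Qed.

(** * Distance to the consensus set *)

Section Distance.
Variables (R : realType) (N : nat).
Implicit Types p : 'M[R]_(N, 3).

Lemma eucl_dist_set_le p p' (S : set 'M[R]_(N, 3)) :
  S p' -> eucl_dist_set p S <= eucl_dist p p'.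
Proof.
move=> Sp'; apply: ge_inf; last by exists p'.
by exists 0 => _ [r _ <-]; exact: sqrtr_ge0.
Qed.

Lemma eucl_dist_consensus p (y0 eps : R) : 0 < eps ->
    (forall i, `|bcast p i - y0| <= eps / N.+1%:R) ->
  eucl_dist p (pack (phys p) (fun=> y0) (clock p)) < eps.
Proof.
move=> eps0 py; have N0 : 0 < N.+1%:R :> R by rewrite ltr0n.
rewrite -[ltRHS]gtr0_norm// -sqrtr_sqr ltr_sqrt ?exprn_gt0//.
apply: (@le_lt_trans _ _ (\sum_(i < N) (eps / N.+1%:R) ^+ 2)).
  apply: ler_sum => i _; rewrite !big_ord_recl big_ord0 !mxE/=.
  have -> : p i ord0 = phys p i by [].
  have -> : p i (lift ord0 ord0) = bcast p i.
    by rewrite /bcast; congr (p i _); apply: val_inj.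
  have -> : p i (lift ord0 (lift ord0 ord0)) = clock p i.
    by rewrite /clock; congr (p i _); apply: val_inj.
  rewrite !subrr expr0n !addr0 add0r -[leLHS]real_normK ?num_real//.
  by rewrite ler_pXn2r// nnegrE// divr_ge0// ltW.
rewrite sumr_const card_ord -[_ *+ N]mulr_natr expr_div_n -mulrA [_^-1 * _]mulrC.
rewrite gtr_pMr ?exprn_gt0// ltr_pdivrMr ?exprn_gt0// mul1r -natrX ltr_nat.
by rewrite (leq_trans (ltnSn N))// leq_pmulr.
Qed.

End Distance.

Theorem theoremV3 (R : realType) (N : nat) (hN : (2 <= N)%N)
    (Gr : wdigraph R N)
    (hbal : weight_balanced Gr)
    (hconn : strongly_connected Gr)
    (sigma : 'I_N -> R)
    (hsigma : forall i, 0 < sigma i < 1)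
    (q : hybrid_arc R N 3)
    (hq : trajectory Gr sigma q) :
  asymptotically_converges q
    [set p : 'M[R]_(N, 3) | forall i, phihat Gr p i = 0].
Proof.
split.
  exact: (trajectory_complete hbal hsigma hq).
move=> eps eps0; pose i0 := Ordinal (ltnW hN).
have N0 : 0 < N.+1%:R :> R by rewrite ltr0n.
have [M MP] : exists M : R, forall i (y : 'I_N -> R) b, 0 <= b ->
    (forall a c, edge Gr a c -> `|y a - y c| <= b) -> `|y i - y i0| <= M * b.
  apply: finite_ub => [i x y xy H z b b0 zb|i].
    by apply: le_trans (H z b b0 zb) _; rewrite ler_wpM2r.
  exact: connect_gap (hconn i i0).
pose b := eps / N.+1%:R / (`|M| + 1).
have M0 : 0 < `|M| + 1 by rewrite ltr_wpDl.
have b0 : 0 < b by rewrite !divr_gt0.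
have [T TP] : exists T, forall (e : 'I_N * 'I_N) t j, edge Gr e.1 e.2 ->
    arc_dom q (t, j) -> T < t ->
    `|bcast (arc_val q t j) e.1 - bcast (arc_val q t j) e.2| <= b.
  apply: finite_ub => [e x y xy H t j ee Et yt|[i k]].
    by apply: H => //; exact: le_lt_trans yt.
  have [eik|nik] := boolP (edge Gr i k); last by exists 0.
  by have [T TP] := gap_cvg hbal hsigma hq eik b0; exists T => t j _; exact: TP.
exists (T + 1) => t j Et Tt; set p := arc_val q t j.
have {}Tt : T < t by rewrite (lt_le_trans _ Tt)// ltrDl.
apply: le_lt_trans (eucl_dist_consensus (y0 := bcast p i0) eps0 _).
  apply: eucl_dist_set_le => i /=.
  by apply: big1 => k _; rewrite !bcast_pack subrr expr0n mulr0.
move=> i; apply: le_trans (MP i (bcast p) b (ltW b0) _) _.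
  by move=> a c ac; exact: (TP (a, c)).
apply: (@le_trans _ _ ((`|M| + 1) * b)).
  by rewrite ler_wpM2r ?(ltW b0)// ler_wpDr// ler_norm.
by rewrite /b mulrC divfK// gt_eqF.
Qed.
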